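(* Let $A$ be a non-negative self-adjoint operator on $L^2(\mu)$ satisfying a Nash-type inequality with non-decreasing rate function $D:[0,+\infty)\to[0,+\infty)$, i.e. for every $f\in\mathcal D(A)\cap L^1(\mu)$ with $\|f\|_1\le1$, $$\|f\|_2^2\,D(\|f\|_2^2)\le(Af,f).$$ Then for every non-negative non-decreasing convex function $\Psi:[0,+\infty)\to[0,+\infty)$ with $\Psi(0)=0$, one has, for every $f\in\mathcal D(\Psi(A))\cap L^1(\mu)$ with $\|f\|_1\le 1$, $$\|f\|_2^2\,(\Psi\circ D)(\|f\|_2^2)\le(\Psi(A)f,f).$$
   Context: $(X,\mu)$ is a $\sigma$-finite measure space, $(\cdot,\cdot)$ is the inner product of $L^2(\mu)$ and $\|\cdot\|_p$ the $L^p(\mu)$-norm. $\Psi(A)=\int_0^{+\infty}\Psi(\lambda)\,dE_\lambda$ is defined through the spectral resolution $(E_\lambda)$ of $A$, with domain $\mathcal D(\Psi(A))=\{f\in L^2:\int_0^{+\infty}|\Psi(\lambda)|^2d(E_\lambda f,f)<\infty\}$. *)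

(* Defs.v *)
From HB Require Import structures.
From mathcomp Require Import all_boot all_order all_algebra complex ring.
From mathcomp Require Import all_classical all_reals all_analysis.

Set Implicit Arguments.
Unset Strict Implicit.
Unset Printing Implicit Defensive.

Import Order.TTheory GRing.Theory Num.Theory.
Import numFieldNormedType.Exports.

Local Open Scope classical_set_scope.
Local Open Scope ring_scope.
Local Open Scope complex_scope.

(* The field of scalars is either the real or the complex numbers.  Scalars
   always live in R[i]; K is the set of those that are allowed. *)
Definition scalar_field (R : realType) (K : set R[i]) : Prop :=
  K = [set z | complex.Im z = 0] \/ K = [set: R[i]].

Section L2.
Context {R : realType} {d : measure_display} {T : measurableType d}.
Variable mu : {measure set T -> \bar R}.
Variable K : set R[i].

Implicit Types (f g h u : T -> R[i]) (p : \bar R).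

(* Functions are not quotiented by almost everywhere equality: every notion
   below respects ae_equal. *)
Definition ae_equal f g : Prop := {ae mu, forall x, f x = g x}.

(* L^p(mu) with values in K *)
Definition Lp p : set (T -> R[i]) :=
  [set f | [/\ forall x, K (f x),
               (fun x => complex.Re (f x)) \in Lfun mu p &
               (fun x => complex.Im (f x)) \in Lfun mu p]].

Definition Lpnorm p f : \bar R :=
  Lnorm mu p (fun x => (Normc.normc (f x))%:E).

Definition inner f g : R[i] :=
  (\int[mu]_x complex.Re (f x * (g x)^*))
    +i* (\int[mu]_x complex.Im (f x * (g x)^*)).

(* An unbounded operator; the values of app outside dom are irrelevant. *)
Record operator := Operator {
  dom : set (T -> R[i]) ;
  app :> (T -> R[i]) -> (T -> R[i]) }.

Implicit Types A B : operator.

Record linear_operator A : Prop := LinearOperator {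
  dom_L2 : dom A `<=` Lp 2 ;
  app_L2 : forall f, dom A f -> Lp 2 (A f) ;
  dom_ae : forall f g, dom A f -> Lp 2 g -> ae_equal f g -> dom A g ;
  app_ae : forall f g, dom A f -> dom A g -> ae_equal f g ->
    ae_equal (A f) (A g) ;
  dom0 : dom A (fun=> 0) ;
  dom_linear : forall c f g, K c -> dom A f -> dom A g ->
    dom A (fun x => c * f x + g x) ;
  app_linear : forall c f g, K c -> dom A f -> dom A g ->
    ae_equal (A (fun x => c * f x + g x)) (fun x => c * A f x + A g x) }.

Definition densely_defined A : Prop :=
  forall f, Lp 2 f -> forall e : R, 0 < e ->
    exists2 g, dom A g & (Lpnorm 2 (fun x => f x - g x)%R < e%:E)%E.

(* (f, g) belongs to the graph of the adjoint of A *)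
Definition adjoint_graph A f g : Prop :=
  [/\ Lp 2 f, Lp 2 g & forall u, dom A u -> inner (A u) f = inner u g].

Definition self_adjoint A : Prop :=
  [/\ linear_operator A, densely_defined A &
      forall f g, adjoint_graph A f g <->
        [/\ dom A f, Lp 2 g & ae_equal (A f) g]].

Definition nonnegative_operator A : Prop :=
  forall f, dom A f -> 0 <= complex.Re (inner (A f) f).

(* Resolutions of the identity carried by [0, +oo[, in the right-continuous
   convention E_l = E(]-oo, l]); the jump E_0 at 0 need not vanish. *)
Record spectral_resolution (E : R -> (T -> R[i]) -> (T -> R[i])) : Prop :=
  SpectralResolution {
  sr_L2 : forall l f, Lp 2 f -> Lp 2 (E l f) ;
  sr_ae : forall l f g, Lp 2 f -> Lp 2 g -> ae_equal f g ->
    ae_equal (E l f) (E l g) ;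
  sr_linear : forall l c f g, K c -> Lp 2 f -> Lp 2 g ->
    ae_equal (E l (fun x => c * f x + g x)) (fun x => c * E l f x + E l g x) ;
  sr_sym : forall l f g, Lp 2 f -> Lp 2 g -> inner (E l f) g = inner f (E l g) ;
  sr_min : forall l m f, Lp 2 f ->
    ae_equal (E l (E m f)) (E (Num.min l m) f) ;
  sr_right_continuous : forall l f, Lp 2 f ->
    Lpnorm 2 (fun x => E m f x - E l f x) @[m --> l^'+] --> 0%E ;
  sr_lt0 : forall l f, l < 0 -> Lp 2 f -> ae_equal (E l f) (fun=> 0) ;
  sr_pinfty : forall f, Lp 2 f ->
    Lpnorm 2 (fun x => E l f x - f x) @[l --> +oo%R] --> 0%E }.

Section cdf.
Variable E : R -> (T -> R[i]) -> (T -> R[i]).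

Definition spectral_cdf f (l : R) : R := complex.Re (inner (E l f) f).

Definition cumulative_of (F : R -> R)
    (F_ndrc : nondecreasing F /\ right_continuous F) : cumulative R R :=
  HB.pack F (isCumulative.Build R _ R F F_ndrc.1 F_ndrc.2).

(* The default value idfun is never used: see spectral_cdf_ndrc. *)
Definition to_cumulative (F : R -> R) : cumulative R R :=
  match pselect (nondecreasing F /\ right_continuous F) with
  | left F_ndrc => cumulative_of F_ndrc
  | right _ => idfun
  end.

(* d(E_l f, f) *)
Definition spectral_measure f :=
  lebesgue_stieltjes_measure (to_cumulative (spectral_cdf f)).

Definition spectral_dom (Psi : R -> R) : set (T -> R[i]) :=
  [set f | Lp 2 f /\
    (\int[spectral_measure f]_(l in `[0%R, +oo[) ((`|Psi l| ^+ 2)%R)%:E < +oo)%E].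

(* B is the operator int_0^{+oo} Psi(l) dE_l.  The measure
   d Re(E_l f, g) is (d(E_l (f+g), f+g) - d(E_l (f-g), f-g)) / 4.  As the
   domain is a dense K-subspace, the real parts of the (B f, g) determine B f. *)
Definition spectral_integral (Psi : R -> R) B : Prop :=
  [/\ linear_operator B, dom B = spectral_dom Psi &
      forall f g, dom B f -> dom B g ->
        complex.Re (inner (B f) g) = 4^-1 *
          ((\int[spectral_measure (fun x => f x + g x)]_(l in `[0, +oo[) Psi l)
         - (\int[spectral_measure (fun x => f x - g x)]_(l in `[0, +oo[) Psi l))].

End cdf.

Definition nash_inequality A (D : R -> R) : Prop :=
  forall f, dom A f -> Lp 1 f -> (Lpnorm 1 f <= 1)%E ->
    fine (Lpnorm 2 f) ^+ 2 * D (fine (Lpnorm 2 f) ^+ 2)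
      <= complex.Re (inner (A f) f).

End L2.

Arguments operator R {d} T.

Section cdf_cumulative.
Context {R : realType} {d : measure_display} {T : measurableType d}.
Variable mu : {measure set T -> \bar R}.
Variable K : set R[i].
Implicit Types f g h : T -> R[i].

Let re f x : R := complex.Re (f x).
Let im f x : R := complex.Im (f x).

Let mul_integrable (a b : T -> R) : a \in Lfun mu 2 -> b \in Lfun mu 2 ->
  mu.-integrable setT (EFin \o (fun x => a x * b x)).
Proof.
move=> a2 b2; exact/(Lfun1_integrable mu (a \* b))/Lfun2_mul_Lfun1.
Qed.

Lemma Re_innerE f g : Lp mu K 2 f -> Lp mu K 2 g ->
  complex.Re (inner mu f g) =
  \int[mu]_x (re f x * re g x) + \int[mu]_x (im f x * im g x).
Proof.
case=> _ rf imf [_ rg img]; rewrite /inner /=.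
rewrite -RintegralD//; [|exact: mul_integrable..].
by apply: eq_Rintegral => x _; rewrite /re /im; case: (f x) (g x) => a b [u v] /=;
  rewrite mulrN opprK.
Qed.

Lemma Re_inner_sym f g : Lp mu K 2 f -> Lp mu K 2 g ->
  complex.Re (inner mu f g) = complex.Re (inner mu g f).
Proof.
move=> f2 g2; rewrite !Re_innerE//.
by congr (_ + _); apply: eq_Rintegral => x _; rewrite mulrC.
Qed.

Lemma Re_inner_ae f g h : Lp mu K 2 f -> Lp mu K 2 g -> Lp mu K 2 h ->
  ae_equal mu g h -> complex.Re (inner mu f g) = complex.Re (inner mu f h).
Proof.
move=> f2 g2 h2 gh; rewrite !Re_innerE//.
case: f2 g2 h2 => _ rf imf [_ rg img] [_ rh imh].
have E (a b c : T -> R) : a \in Lfun mu 2 -> b \in Lfun mu 2 ->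
    c \in Lfun mu 2 -> {ae mu, forall x, b x = c x} ->
    \int[mu]_x (a x * b x) = \int[mu]_x (a x * c x).
  move=> a2 b2 c2 bc; congr fine; apply: ae_eq_integral => //.
  - exact: measurable_int (mul_integrable a2 b2).
  - exact: measurable_int (mul_integrable a2 c2).
  - by apply: filterS bc => x -> _.
by congr (_ + _); apply: E => //; apply: filterS gh => x; rewrite /re /im => ->.
Qed.

Lemma Re_inner_sub f g : Lp mu K 2 f -> Lp mu K 2 g ->
  \int[mu]_x (Normc.normc (f x - g x) ^+ 2) = complex.Re (inner mu f f)
    - 2 * complex.Re (inner mu f g) + complex.Re (inner mu g g).
Proof.
move=> f2 g2; rewrite !Re_innerE//.
case: f2 g2 => _ rf imf [_ rg img].
have E (a b : T -> R) : a \in Lfun mu 2 -> b \in Lfun mu 2 ->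
    (mu.-integrable setT (EFin \o (fun x => (a x - b x) * (a x - b x)))) /\
    \int[mu]_x ((a x - b x) * (a x - b x)) = \int[mu]_x (a x * a x)
      - 2 * \int[mu]_x (a x * b x) + \int[mu]_x (b x * b x).
  move=> a2 b2.
  have i2 : mu.-integrable setT (EFin \o (fun x => 2 * (a x * b x))).
    exact: (integrableZl measurableT 2 (mul_integrable a2 b2)).
  have i3 := integrableB measurableT (mul_integrable a2 a2) i2.
  have i4 := integrableD measurableT i3 (mul_integrable b2 b2).
  split; first by apply: eq_integrable i4 => // x _ /=; congr EFin; ring.
  rewrite -RintegralZl//; last exact: mul_integrable.
  rewrite -RintegralB//; last exact: mul_integrable.
  rewrite -RintegralD//; last exact: mul_integrable.
  by apply: eq_Rintegral => x _; ring.
have [i1 e1] := E _ _ rf rg; have [i2 e2] := E _ _ imf img.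
rewrite /re /im; transitivity (
  \int[mu]_x ((re f x - re g x) * (re f x - re g x)) +
  \int[mu]_x ((im f x - im g x) * (im f x - im g x))).
  rewrite -RintegralD//; apply: eq_Rintegral => x _.
  rewrite /re /im; case: (f x) (g x) => a b [u v] /=.
  by rewrite sqr_sqrtr ?addr_ge0 ?sqr_ge0// !expr2.
by rewrite e1 e2 /re /im; ring.
Qed.

Variable E : R -> (T -> R[i]) -> (T -> R[i]).
Hypothesis hE : spectral_resolution mu K E.

Lemma spectral_cdfB f l m : Lp mu K 2 f -> l <= m ->
  spectral_cdf mu E f m - spectral_cdf mu E f l
  = \int[mu]_x (Normc.normc (E m f x - E l f x) ^+ 2).
Proof.
move=> f2 lm; rewrite Re_inner_sub; [|exact: (sr_L2 hE)..].
have H k n : complex.Re (inner mu (E k f) (E n f))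
    = spectral_cdf mu E f (Num.min k n).
  rewrite (sr_sym hE)//; last exact: (sr_L2 hE).
  rewrite (@Re_inner_ae _ _ (E (Num.min k n) f)) ?(sr_min hE)//.
  - by rewrite Re_inner_sym//; exact: (sr_L2 hE).
  - by do 2 apply: (sr_L2 hE).
  - exact: (sr_L2 hE).
  - exact: (sr_min hE).
by rewrite !H !minxx min_r//; ring.
Qed.

Lemma spectral_cdf_ndrc f : Lp mu K 2 f ->
  nondecreasing (spectral_cdf mu E f) /\ right_continuous (spectral_cdf mu E f).
Proof.
move=> f2; split.
  move=> l m lm; rewrite -subr_ge0 spectral_cdfB//.
  by apply: Rintegral_ge0 => x _; rewrite sqr_ge0.
move=> l; apply: (@cvg_sub0 _ _ _ _ _ _ (cst (spectral_cdf mu E f l))); last first.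
  exact: cvg_cst.
have /fine_cvg N0 := sr_right_continuous hE l f2.
have : fine (Lpnorm mu 2 (fun x => E m f x - E l f x)) ^+ 2 @[m --> l^'+] --> 0.
  rewrite -[X in _ --> X](mulr0 (0 : R)); exact: (cvgM N0 N0).
apply: cvg_trans; apply: near_eq_cvg; near=> m.
have lm : l <= m by near: m; exact: nbhs_right_ge.
rewrite -[RHS]/(_ - _) spectral_cdfB//.
rewrite -powR_mulrn ?fine_ge0 ?Lnorm_ge0// -fine_poweR poweR_Lnorm//.
congr fine; apply: eq_integral => x _.
rewrite abse_EFin poweR_EFin powR_mulrn//; congr EFin; rewrite ger0_norm//.
by case: (_ - _) => a b; exact: sqrtr_ge0.
Unshelve. all: by end_near. Qed.

End cdf_cumulative.

(* Main.v *)
Require Import Defs.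
From mathcomp Require Import all_boot all_order all_algebra complex ring lra.
From mathcomp Require Import all_classical all_reals all_analysis.
From mathcomp Require Import measurable_realfun.

(** Write nu_f for the spectral measure d(E_l f, f), so that
    (Psi(A)f, f) = int Psi dnu_f, and nu_f has total mass at most ||f||_2^2.
    The inequality is Jensen's inequality for nu_f, in the following guise.
    Let s = ||f||_2^2 and t = D(s).  If Psi(t) = 0 there is nothing to prove.
    Otherwise t > 0, and a convex Psi with Psi(0) = 0 < Psi(t) has a supporting
    line at t of positive slope c: Psi(l) >= Psi(t) + c (l - t) for l >= 0
    ([convex_supporting_line]).

    The positive slope is used twice.  First, l <= t + Psi(l) / c, so that a
    vector in the domain of Psi(A) lies in the domain of A, because nu_f is
    finite ([sqr_integral_lty]): the Nash inequality for A applies to f and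
    gives s t <= int l dnu_f.  Secondly, integrating the supporting line,
      int Psi dnu_f >= (Psi(t) - c t) nu_f([0, +oo[) + c int l dnu_f
                    >= (Psi(t) - c t) s + c s t = s Psi(t).
    The last step multiplies nu_f([0, +oo[) <= s ([spectral_measure_le]), which
    follows from 0 <= (E_l f, f) <= (f, f), by the intercept Psi(t) - c t, which
    is at most Psi(0) = 0.

    The quadratic form of Psi(A) is given by polarization, as a quarter of the
    difference of integrals against nu_(f+f) and nu_(f-f) = 0.  The supporting
    line is therefore integrated against nu_g with g = f + f and (g, g) = 4 s,
    for which (Psi(A)f, f) = (1/4) int Psi dnu_g and s t <= (1/4) int l dnu_g. *)

Set Implicit Arguments.
Unset Strict Implicit.
Unset Printing Implicit Defensive.

Import Order.TTheory GRing.Theory Num.Theory.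
Import numFieldNormedType.Exports.

Local Open Scope classical_set_scope.
Local Open Scope ring_scope.
Local Open Scope complex_scope.

(** * Supporting lines of convex functions on the half-line *)

Section convex.
Variables (R : realType) (Psi : R -> R).
Hypothesis Psi_cvx : convex_function (`[0, +oo[%classic : set R^o) Psi.

(** Convexity with the barycentric coordinates of t in [x, y], cleared of the
    denominator y - x so that the degenerate case x = y is included. *)
Lemma convex_chord (x t y : R) : 0 <= x -> x <= t -> t <= y ->
  (y - x) * Psi t <= (y - t) * Psi x + (t - x) * Psi y.
Proof.
move=> x0 xt ty; have [exy|xy] := eqVneq x y.
  have -> : t = x by apply/le_anti; rewrite xt exy ty.
  by rewrite exy !subrr !mul0r addr0.
have {}xy : 0 < y - x by rewrite subr_gt0 lt_neqAle xy (le_trans xt ty).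
have l0 : 0 <= (y - t) / (y - x) by rewrite divr_ge0 ?(ltW xy) ?subr_ge0.
have l1 : (y - t) / (y - x) <= 1 by rewrite ler_pdivrMr // mul1r; lra.
have xI : (x : R^o) \in (`[0, +oo[%classic : set R^o).
  by rewrite inE /= in_itv /= andbT.
have yI : (y : R^o) \in (`[0, +oo[%classic : set R^o).
  by rewrite inE /= in_itv /= andbT; lra.
have := Psi_cvx (Itv01 l0 l1) xI yI.
rewrite convRE [X in Psi X]convRE /= /unstable.onem.
have -> : (y - t) / (y - x) * x + (1 - (y - t) / (y - x)) * y = t.
  by field; rewrite gt_eqF.
move=> /(ler_wpM2l (ltW xy)); congr (_ <= _).
by field; rewrite gt_eqF.
Qed.

(** The slope is the supremum of the slopes of the chords ending at t.  Chords
    starting at t bound it from above; the chord from the origin, of slope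
    Psi t / t, makes it positive. *)
Lemma convex_supporting_line (t : R) : 0 < t -> Psi 0 = 0 -> 0 < Psi t ->
  exists2 c, 0 < c & forall x, 0 <= x -> Psi t + c * (x - t) <= Psi x.
Proof.
move=> t0 Psi0 Psit0.
pose slopes := [set (Psi t - Psi x) / (t - x) | x in `[0, t[].
have slope_le (x y : R) : 0 <= x -> x < t -> t < y ->
    (Psi t - Psi x) / (t - x) <= (Psi y - Psi t) / (y - t).
  move=> x0 xt ty; rewrite ler_pdivrMr ?subr_gt0 // mulrAC.
  rewrite ler_pdivlMr ?subr_gt0 //.
  by have := convex_chord x0 (ltW xt) (ltW ty); lra.
have slope0 : slopes (Psi t / t).
  by exists 0; rewrite ?Psi0 ?subr0 //= in_itv /= lexx.
have slopes_sup : has_sup slopes.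
  split; first by exists (Psi t / t).
  exists ((Psi (t + 1) - Psi t) / (t + 1 - t)) => _ [x /= + <-].
  by rewrite in_itv /= => /andP[x0 xt]; apply: slope_le => //; lra.
exists (sup slopes).
  apply: (lt_le_trans (divr_gt0 Psit0 t0)).
  by apply: ub_le_sup => //; case: slopes_sup.
move=> x x0; have [xt|tx|->] := ltgtP x t; last by rewrite subrr mulr0 addr0.
- have : (Psi t - Psi x) / (t - x) <= sup slopes.
    apply: ub_le_sup; first by case: slopes_sup.
    by exists x => //=; rewrite in_itv /= x0.
  by rewrite ler_pdivrMr ?subr_gt0 //; lra.
- have : sup slopes <= (Psi x - Psi t) / (x - t).
    apply: ge_sup; first by case: slopes_sup.
    by move=> _ [z /= + <-]; rewrite in_itv /= => /andP[z0 zt]; apply: slope_le.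
  by rewrite ler_pdivlMr ?subr_gt0 //; lra.
Qed.

End convex.

(** * Square integrability on a set of finite mass *)

Section finite_mass.
Local Open Scope ereal_scope.
Context d (T : measurableType d) (R : realType).
Variables (mu : {measure set T -> \bar R}) (D : set T).
Hypotheses (mD : measurable D) (muD : mu D < +oo).
Implicit Types f g : T -> R.

Lemma finite_mass_integrable_cst (k : R) : mu.-integrable D (EFin \o cst k).
Proof.
apply: measurable_bounded_integrable => //.
by exists `|k|%R; split; [exact: num_real|move=> r kr x _; exact: ltW].
Qed.

Let sqr_integrable f : measurable_fun D f ->
  \int[mu]_(x in D) ((`|f x| ^+ 2)%R)%:E < +oo ->
  mu.-integrable D (EFin \o (fun x => `|f x| ^+ 2)%R).
Proof.
move=> mf f2; apply/integrableP; split.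
  by apply/measurable_EFinP/measurable_funX; exact: measurableT_comp.
by under eq_integral => x _ do rewrite /= ger0_norm ?exprn_ge0//.
Qed.

Lemma sqr_integral_lty_integrable f : measurable_fun D f ->
  \int[mu]_(x in D) ((`|f x| ^+ 2)%R)%:E < +oo ->
  mu.-integrable D (EFin \o f).
Proof.
move=> mf f2.
have := integrableD mD (finite_mass_integrable_cst 1) (sqr_integrable mf f2).
apply: le_integrable => //; first exact/measurable_EFinP.
move=> x Dx /=; rewrite lee_fin; apply: le_trans (ler_norm _).
by have := sqr_ge0 (1 - `|f x|)%R; have := normr_ge0 (f x); nra.
Qed.

(** Constants are square integrable on a set of finite mass, so affine
    domination preserves square integrability. *)
Lemma sqr_integral_lty f g (a b : R) : measurable_fun D f ->
  measurable_fun D g ->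
  (forall x, D x -> `|g x| <= a + b * `|f x|)%R ->
  \int[mu]_(x in D) ((`|f x| ^+ 2)%R)%:E < +oo ->
  \int[mu]_(x in D) ((`|g x| ^+ 2)%R)%:E < +oo.
Proof.
move=> mf mg gf f2.
have ih := integrableD mD (finite_mass_integrable_cst (2 * a ^+ 2))
  (integrableZl mD (2 * b ^+ 2) (sqr_integrable mf f2)).
have /integrableP[_] : mu.-integrable D (EFin \o (fun x => `|g x| ^+ 2)%R).
  apply: le_integrable ih => //.
    by apply/measurable_EFinP/measurable_funX; exact: measurableT_comp.
  move=> x Dx /=; rewrite lee_fin; apply: le_trans (ler_norm _).
  rewrite ger0_norm ?exprn_ge0//.
  have : (`|g x| ^+ 2 <= (a + b * `|f x|) ^+ 2)%R.
    by rewrite lerXn2r ?nnegrE ?(le_trans (normr_ge0 _) (gf _ Dx))//; exact: gf.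
  by have := sqr_ge0 (a - b * `|f x|)%R; nra.
by under eq_integral => x _ do rewrite /= ger0_norm ?exprn_ge0//.
Qed.

End finite_mass.

(** * Mass of a Stieltjes measure *)

Section stieltjes_mass.
Variable R : realType.
Local Open Scope measure_display_scope.

(** The whole line is the increasing union of the intervals ]-n, n], of mass
    F n - F (-n). *)
Lemma le_stieltjes_mass (F : cumulative R R) (m M : R)
    (A : set (measurableTypeR R)) :
  (forall l, m <= F l <= M) -> measurable A ->
  (lebesgue_stieltjes_measure F A <= (M - m)%:E)%E.
Proof.
move=> FmM mA; apply: (@le_trans _ _ (lebesgue_stieltjes_measure F setT)).
  by apply: le_measure; rewrite ?inE.
rewrite -(bigcup_itvT false false).
pose I n : set R := `]- (n%:R), n%:R]%classic.
have FI n : lebesgue_stieltjes_measure F (I n) = (F n%:R - F (- n%:R))%:E.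
  rewrite /lebesgue_stieltjes_measure /measure_extension measurable_mu_extE/=.
    by rewrite wlength_itv_bnd// ge0_cp.
  exact: is_ocitv.
have : (lebesgue_stieltjes_measure F \o I) n @[n --> \oo] -->
    lebesgue_stieltjes_measure F (\bigcup_n I n).
  apply: nondecreasing_cvg_mu; rewrite /I//; first exact: bigcup_measurable.
  by move=> *; apply/subsetPset/subset_itv; rewrite leBSide/= ?lerN2 ler_nat.
move=> cF; apply: (@cvge_to_le _ _ _ _ _ _ _ cF).
apply: nearW => n /=; rewrite FI lee_fin.
by have /andP[_ ?] := FmM n%:R; have /andP[? _] := FmM (- n%:R); rewrite lerB.
Qed.

End stieltjes_mass.

(** * Spectral measures and quadratic forms *)

Section spectral_measure.
Context {R : realType} {d : measure_display} {T : measurableType d}.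
Variables (mu : {measure set T -> \bar R}) (K : set R[i]).
Variable E : R -> (T -> R[i]) -> (T -> R[i]).
Hypothesis hE : spectral_resolution mu K E.
Implicit Types f g : T -> R[i].

Lemma Re_inner_ge0 f : 0 <= complex.Re (inner mu f f).
Proof.
rewrite /inner /=; apply: Rintegral_ge0 => x _.
by case: (f x) => a b /=; rewrite mulrN opprK -!expr2 addr_ge0 ?sqr_ge0.
Qed.

Lemma Re_inner_double f : Lp mu K 2 f ->
  complex.Re (inner mu (fun x => f x + f x) (fun x => f x + f x))
  = 4 * complex.Re (inner mu f f).
Proof.
move=> [_ rf imf]; rewrite /inner /=.
have sqi (a : T -> R) : a \in Lfun mu 2 ->
    mu.-integrable setT (EFin \o (fun x => a x * a x)).
  by move=> a2; exact/(Lfun1_integrable mu (a \* a))/Lfun2_mul_Lfun1.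
rewrite -RintegralZl//.
  by apply: eq_Rintegral => x _; case: (f x) => a b /=; ring.
have := integrableD measurableT (sqi _ rf) (sqi _ imf).
apply: eq_integrable => // x _ /=; congr EFin.
by case: (f x) => a b /=; ring.
Qed.

Lemma Lpnorm2_sqr f : fine (Lpnorm mu 2 f) ^+ 2 = complex.Re (inner mu f f).
Proof.
rewrite -powR_mulrn ?fine_ge0 ?Lnorm_ge0// -fine_poweR poweR_Lnorm//.
rewrite /inner [RHS]/=; congr fine; apply: eq_integral => x _.
rewrite abse_EFin poweR_EFin powR_mulrn//; congr EFin.
case: (f x) => a b /=; rewrite ger0_norm ?sqrtr_ge0//.
by rewrite sqr_sqrtr ?addr_ge0 ?sqr_ge0//; ring.
Qed.

(** E_l is an orthogonal projection: (E_l f, f) = ||E_l f||^2, and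
    (f, f) - (E_l f, f) = ||f - E_l f||^2. *)
Lemma spectral_cdf_bound f l : Lp mu K 2 f ->
  0 <= spectral_cdf mu E f l <= complex.Re (inner mu f f).
Proof.
move=> f2; have El2 := sr_L2 hE l f2.
have cdfE : complex.Re (inner mu (E l f) (E l f)) = spectral_cdf mu E f l.
  rewrite (sr_sym hE)// (Re_inner_ae (K := K) f2 _ El2).
  - exact: Re_inner_sym f2 El2.
  - exact: (sr_L2 hE).
  - by have := sr_min hE l l f2; rewrite minxx.
rewrite -{1}cdfE Re_inner_ge0 -subr_ge0 /=.
have := Re_inner_sub f2 El2.
rewrite cdfE (Re_inner_sym f2 El2) -/(spectral_cdf mu E f l) => H.
have -> : complex.Re (inner mu f f) - spectral_cdf mu E f l =
    complex.Re (inner mu f f) - 2 * spectral_cdf mu E f l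
      + spectral_cdf mu E f l.
  by ring.
by rewrite -H; apply: Rintegral_ge0 => x _; exact: sqr_ge0.
Qed.

Lemma to_cumulativeE (F : R -> R) : nondecreasing F /\ right_continuous F ->
  to_cumulative F = F :> (R -> R).
Proof. by rewrite /to_cumulative; case: pselect. Qed.

Lemma spectral_measure_le f (A : set (measurableTypeR R)) :
  Lp mu K 2 f -> measurable A ->
  (spectral_measure mu E f A <= (complex.Re (inner mu f f))%:E)%E.
Proof.
move=> f2 mA; rewrite -[X in X%:E]subr0; apply: le_stieltjes_mass => // l.
by rewrite (to_cumulativeE (spectral_cdf_ndrc hE f2)) spectral_cdf_bound.
Qed.

Lemma Rintegral_spectral_measure0 (D : set (measurableTypeR R)) (h : R -> R) :
  Lp mu K 2 (fun=> 0) -> measurable D -> measurable_fun D h ->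
  \int[spectral_measure mu E (fun=> 0)]_(l in D) h l = 0.
Proof.
move=> L0 mD mh; rewrite /Rintegral null_set_integral //.
  exact/measurable_EFinP.
apply/eqP; rewrite eq_le measure_ge0 andbT.
apply: le_trans (spectral_measure_le L0 mD) _.
rewrite /inner /= lee_fin /Rintegral integral0_eq // => x _.
by rewrite !mul0r subrr.
Qed.

(** This is the polarization formula on the diagonal, where the second spectral
    measure is that of f - f = 0. *)
Lemma spectral_quadratic_form (Psi : R -> R) B f :
  K 1 -> measurable_fun (`[0, +oo[ : set (measurableTypeR R)) Psi ->
  spectral_integral mu K E Psi B -> dom B f ->
  complex.Re (inner mu (B f) f) = 4^-1 *
    \int[spectral_measure mu E (fun x => f x + f x)]_(l in `[0, +oo[) Psi l.
Proof.
move=> K1 mPsi [linB domB formB] Bf; rewrite formB//.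
have -> : (fun x => f x - f x) = (fun=> 0) by apply/funext => x; rewrite subrr.
have int0 := Rintegral_spectral_measure0 (dom_L2 linB (dom0 linB))
  (measurable_itv `[0%R, +oo[) mPsi.
by rewrite [X in _ - X]int0 subr0.
Qed.

Lemma dom_double (B : operator R T) f : K 1 -> linear_operator mu K B ->
  dom B f -> dom B (fun x => f x + f x).
Proof.
move=> K1 linB Bf; have := dom_linear linB K1 Bf Bf.
by under eq_fun do rewrite mul1r.
Qed.

End spectral_measure.

(** * The Nash inequality for Psi(A) *)

(** Psi is arbitrary on the negative half-line; its extension there by the
    constant Psi 0 is nondecreasing on the whole line. *)
Lemma nondecreasing_measurable_ge0 (R : realType) (Psi : R -> R) :
  (forall x y : R, 0 <= x -> x <= y -> Psi x <= Psi y) ->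
  measurable_fun (`[0, +oo[ : set (measurableTypeR R)) Psi.
Proof.
move=> Psi_nd.
apply: (@eq_measurable_fun _ _ _ _ _ (fun x : R => Psi (Num.max 0 x))).
  by move=> x; rewrite inE /= in_itv /= andbT => x0; rewrite max_r.
apply: nondecreasing_measurable; first exact: measurable_itv.
move=> x y xy; apply: Psi_nd; first by rewrite le_max lexx.
by rewrite ge_max !le_max lexx xy orbT.
Qed.

Theorem proposition5p1 (R : realType) (d : measure_display)
  (T : measurableType d) (mu : {sigma_finite_measure set T -> \bar R})
  (K : set R[i]) (hK : scalar_field K)
  (A : operator R T) (hA : self_adjoint mu K A)
  (hA0 : nonnegative_operator mu A)
  (E : R -> (T -> R[i]) -> (T -> R[i])) (hE : spectral_resolution mu K E)
  (hEA : spectral_integral mu K E idfun A)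
  (D : R -> R) (hD0 : forall x : R, 0 <= x -> 0 <= D x)
  (hDmono : forall x y : R, 0 <= x -> x <= y -> D x <= D y)
  (hNash : nash_inequality mu K A D) :
  forall Psi : R -> R,
    (forall x : R, 0 <= x -> 0 <= Psi x) ->
    (forall x y : R, 0 <= x -> x <= y -> Psi x <= Psi y) ->
    convex_function (`[0, +oo[%classic : set R^o) Psi ->
    Psi 0 = 0 ->
    forall PsiA : operator R T, spectral_integral mu K E Psi PsiA ->
    nash_inequality mu K PsiA (Psi \o D).
Proof.
move=> Psi Psi_ge0 Psi_nd Psi_cvx Psi0 PsiA hPsi f domf f1 normf1.
have K1 : K 1 by case: hK => ->.
have [linP domPE _] := hPsi; have [_ domAE _] := hEA.
have mPsi := nondecreasing_measurable_ge0 Psi_nd.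
have mid : measurable_fun (`[0, +oo[ : set (measurableTypeR R))
    (idfun : R -> R).
  exact: measurable_id.
have mI : measurable (`[0%R, +oo[ : set (measurableTypeR R)).
  exact: (measurable_itv `[0%R, +oo[).
have f2 : Lp mu K 2 f by exact: dom_L2 linP f domf.
rewrite (spectral_quadratic_form hE K1 mPsi hPsi domf).
set g := fun x => f x + f x; set s := _ ^+ 2; rewrite [(Psi \o D) s]/=.
have domg : dom PsiA g := dom_double K1 linP domf.
have g2 : Lp mu K 2 g := dom_L2 linP domg.
have gE : complex.Re (inner mu g g) = 4 * s.
  by rewrite /s Lpnorm2_sqr (Re_inner_double f2).
have s0 : 0 <= s by exact: sqr_ge0.
have I_ge0 l : `[0, +oo[%classic l -> 0 <= l by rewrite /= in_itv /= andbT.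
have intPsi_ge0 : 0 <= \int[spectral_measure mu E g]_(l in `[0, +oo[) Psi l.
  by apply: Rintegral_ge0 => l /I_ge0; exact: Psi_ge0.
have t0 : 0 <= D s := hD0 _ s0.
move: (Psi_ge0 _ t0); rewrite le_eqVlt => /orP[/eqP <-|Psit0].
  by rewrite mulr0 mulr_ge0 ?invr_ge0.
have t_gt0 : 0 < D s.
  rewrite lt_neqAle t0 andbT.
  by apply: contraTneq Psit0 => <-; rewrite Psi0 ltxx.
have [c c0 cPsi] := convex_supporting_line Psi_cvx t_gt0 Psi0 Psit0.
(* The positive slope turns the supporting line into a bound of l by Psi l. *)
have idPsi l : `[0, +oo[%classic l -> `|l| <= D s + c^-1 * `|Psi l|.
  move=> /I_ge0 l0; rewrite ger0_norm// (ger0_norm (Psi_ge0 _ l0)).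
  rewrite -lerBlDl ler_pdivlMl//; apply: le_trans (cPsi l l0).
  by rewrite lerDr ltW.
have fin_mass h : Lp mu K 2 h ->
    (spectral_measure mu E h `[0%R, +oo[%classic < +oo)%E.
  move=> h2; apply: le_lt_trans (spectral_measure_le hE h2 mI) _.
  by rewrite ltry.
have sqrPsi h : dom PsiA h -> (\int[spectral_measure mu E h]_(l in `[0%R, +oo[)
    ((`|Psi l| ^+ 2)%R)%:E < +oo)%E.
  by rewrite domPE => -[].
have sqrid h : dom PsiA h -> (\int[spectral_measure mu E h]_(l in `[0%R, +oo[)
    ((`|idfun l| ^+ 2)%R)%:E < +oo)%E.
  move=> domh; have mh := fin_mass h (dom_L2 linP domh).
  exact: (sqr_integral_lty mI mh mPsi mid idPsi (sqrPsi h domh)).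
have domPsi_domA h : dom PsiA h -> dom A h.
  move=> domh; rewrite domAE.
  by split; [exact: dom_L2 linP h domh|exact: sqrid].
have domAf := domPsi_domA f domf.
have mg := fin_mass g g2.
have iid := sqr_integral_lty_integrable mI mg mid (sqrid g domg).
have iPsi := sqr_integral_lty_integrable mI mg mPsi (sqrPsi g domg).
have := hNash f domAf f1 normf1.
rewrite (spectral_quadratic_form hE K1 mid hEA domAf) -/g -/s => nash.
pose M := fine (spectral_measure mu E g `[0%R, +oo[%classic).
have M_le : M <= 4 * s.
  rewrite -lee_fin -gE fineK; first exact: (spectral_measure_le hE g2 mI).
  by rewrite ge0_fin_numE ?measure_ge0 ?mg.
have icst := finite_mass_integrable_cst mI mg (Psi (D s) - c * D s).
have iline := integrableD mI icst (integrableZl mI c iid).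
(* The supporting line at D s, integrated against the spectral measure of g. *)
have line : (Psi (D s) - c * D s) * M +
    c * \int[spectral_measure mu E g]_(l in `[0, +oo[) l <=
    \int[spectral_measure mu E g]_(l in `[0, +oo[) Psi l.
  rewrite -Rintegral_cst// -RintegralZl// -RintegralD//; last first.
    exact: (integrableZl mI c iid).
  apply: le_Rintegral => // l /I_ge0 l0.
  by apply: le_trans (cPsi l l0); rewrite mulrBr addrA addrAC.
have int_coef : Psi (D s) - c * D s <= 0.
  by have := cPsi 0 (lexx 0); rewrite Psi0 sub0r mulrN.
have := ler_wnM2l int_coef M_le.
have := ler_wpM2l (ltW c0) nash.
by move: line; move: (Rintegral _ _ _) (Rintegral _ _ _) => u v; lra.
Qed.
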